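(* Let $(K,L,\star)$ be a pointed Kan pair. The following sequence is exact and natural in $(K,L,\star)$: $$\cdots\xrightarrow{p_*}\pi_{n+1}(K,L,\star)\xrightarrow{\partial_*}\pi_n(L,\star)\xrightarrow{i_*}\pi_n(K,\star)\xrightarrow{p_*}\pi_n(K,L,\star)\xrightarrow{\partial_*}\cdots$$ $$\cdots\xrightarrow{p_*}\pi_1(K,L,\star)\xrightarrow{\partial_*}\pi_0(L,\star)\xrightarrow{i_*}\pi_0(K,\star)\to\pi_0(K,\star)/\pi_0(L,\star).$$ Here $i\colon L\to K$ is the inclusion with $i_*[x]=[x]$, $p_*\colon\pi_n(K,\star)\to\pi_n(K,L,\star)$ is $p_*[x]=[x]$ (for $n\ge1$), and $\partial_*[x]=[d_0x]$.
   Context: For a simplicial set $K$ with face maps $d_i$ and degeneracy maps $s_i$, write $\partial x=(d_0x,\dots,d_nx)$ for $x\in K_n$. A tuple $(x_0,\dots,x_{n+1})$ of $n$-simplices is an $n$-cycle if $d_ix_j=d_{j-1}x_i$ for all $0\le i<j\le n+1$; it is ''filled'' if it equals $\partial x$ for some $(n+1)$-simplex $x$. Conditions on faces of $0$-simplices are vacuous. A Kan complex is a simplicial set satisfying the Kan (horn filling) condition. A pointed Kan pair $(K,L,\star)$ consists of Kan complexes $L\subset K$ with $L$ a simplicial subset and $\star\in L_0$ a base point; its degenerate images in each dimension are also denoted $\star$. Homotopy: $x,y\in K_n$ with $\partial x=\partial y$ satisfy $x\sim y$ if $(s_{n-1}d_0x,\dots,s_{n-1}d_{n-1}x,x,y)$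 is filled. Relative homotopy ($n\ge1$): $x\sim_{\mathrm{rel}L}y$ if $d_ix=d_iy$ for $1\le i\le n$, $d_0x,d_0y\in L_{n-1}$, and for some $h_L\in L_n$ the tuple $(h_L,s_{n-1}d_1x,\dots,s_{n-1}d_{n-1}x,x,y)$ is a cycle filled in $K$. $\pi_n(K,\star)=\{x\in K_n:\partial x=(\star,\dots,\star)\}/\!\sim$ for $n\ge0$, a group for $n\ge1$ with $[x][y]=[xy]$ whenever $(\star,\dots,\star,y,xy,x)$ is filled. $\pi_n(K,L,\star)=\{x\in K_n:\partial x=(l,\star,\dots,\star),\ l\in L_{n-1}\}/\!\sim_{\mathrm{rel}L}$ for $n\ge1$, a group for $n\ge2$ with $[x][y]=[xy]$ whenever $(h,\star,\dots,\star,y,xy,x)$ is filled in $K$ for some $h\in L_n$. All these sets are pointed by $[\star]$. $\pi_0(K,\star)/\pi_0(L,\star)$ is the pointed set obtained from $\pi_0(K,\star)$ by collapsing the image of $i_*$ to the base point. Exactness means that the image of each map equals the preimage of the base point (neutral element) under the next map. *)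

(* Defs.v *)
From HB Require Import structures.
From Corelib Require Import RelationClasses.
#[warnings="-notation-overridden"] From mathcomp Require Export all_boot.
From mathcomp Require Export classical_sets.
From mathcomp Require Import boolp classical_sets zify.

Set Implicit Arguments.
Unset Strict Implicit.
Unset Printing Implicit Defensive.

Local Open Scope classical_set_scope.
Local Open Scope quotient_scope.

(** * Simplicial sets *)

(* [inord] turns the natural number indices of the simplicial identities into
   ordinals; the stated bounds keep every index in range. *)
Record sset := SSet {
  cell :> nat -> Type;
  face : forall n, 'I_n.+2 -> cell n.+1 -> cell n;
  degen : forall n, 'I_n.+1 -> cell n -> cell n.+1;
  face_face : forall n i j (x : cell n.+2), i < j <= n.+2 ->
    face (inord i) (face (inord j) x)
    = face (inord j.-1) (face (inord i) x);
  face_degen_lt : forall n i j (x : cell n.+1), i < j <= n.+1 ->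
    face (inord i) (degen (inord j) x)
    = degen (inord j.-1) (face (inord i) x);
  face_degen_eq : forall n j (x : cell n), j <= n ->
    face (inord j) (degen (inord j) x) = x;
  face_degen_eqS : forall n j (x : cell n), j <= n ->
    face (inord j.+1) (degen (inord j) x) = x;
  face_degen_gt : forall n i j (x : cell n.+1), j.+1 < i <= n.+2 ->
    face (inord i) (degen (inord j) x)
    = degen (inord j) (face (inord i.-1) x);
  degen_degen : forall n i j (x : cell n), i <= j <= n ->
    degen (inord i) (degen (inord j) x)
    = degen (inord j.+1) (degen (inord i) x)
}.

Definition d (K : sset) n (i : nat) (x : K n.+1) : K n := face (inord i) x.
Definition s (K : sset) n (i : nat) (x : K n) : K n.+1 := degen (inord i) x.

Record smap (K K' : sset) := SMap {
  sfun :> forall n, K n -> K' n;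
  sfun_face : forall n (i : 'I_n.+2) (x : K n.+1),
    sfun (face i x) = face i (sfun x);
  sfun_degen : forall n (i : 'I_n.+1) (x : K n),
    sfun (degen i x) = degen i (sfun x)
}.

(* Tuples of simplices are functions on [nat]; only the entries in the range
   of indices at hand are ever looked at. A filled tuple is a cycle by the
   identities between face maps. *)
Definition filled (K : sset) n (t : nat -> K n) : Prop :=
  exists w : K n.+1, forall i, i <= n.+1 -> d i w = t i.

Definition horn (K : sset) n (k : nat) : (nat -> K n) -> Prop :=
  match n with
  | 0 => fun _ => True
  | m.+1 => fun t => forall i j, i < j <= m.+2 -> i != k -> j != k ->
              d i (t j) = d j.-1 (t i)
  end.

Definition kan (K : sset) : Prop :=
  forall n k (t : nat -> K n), k <= n.+1 -> horn k t ->
  exists w : K n.+1, forall i, i <= n.+1 -> i != k -> d i w = t i.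

(** * Simplicial subsets *)

Record subset (K : sset) := Subset {
  mem_sub : forall n, set (K n);
  mem_face : forall n (i : 'I_n.+2) (x : K n.+1),
    mem_sub x -> mem_sub (face i x);
  mem_degen : forall n (i : 'I_n.+1) (x : K n),
    mem_sub x -> mem_sub (degen i x)
}.

Lemma sval_inj (T : Type) (P : T -> Prop) (x y : {z | P z}) :
  sval x = sval y -> x = y.
Proof.
case: x y => [x px] [y py] /= xy; subst y.
by rewrite (Prop_irrelevance px py).
Qed.

Section SubSset.
Variables (K : sset) (L : subset K).

Definition sub_cell n := {x : K n | mem_sub L x}.
Definition sub_face n (i : 'I_n.+2) (x : sub_cell n.+1) : sub_cell n :=
  exist _ (face i (sval x)) (mem_face i (svalP x)).
Definition sub_degen n (i : 'I_n.+1) (x : sub_cell n) : sub_cell n.+1 :=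
  exist _ (degen i (sval x)) (mem_degen i (svalP x)).

Definition sub_sset : sset.
Proof.
by apply: (@SSet sub_cell sub_face sub_degen) => *; apply: sval_inj => /=;
  [exact: face_face|exact: face_degen_lt|exact: face_degen_eq
  |exact: face_degen_eqS|exact: face_degen_gt|exact: degen_degen].
Defined.

Definition sub_incl : smap sub_sset K :=
  @SMap sub_sset K (fun n x => sval x)
    (fun _ _ _ => erefl) (fun _ _ _ => erefl).
End SubSset.

(** * Pointed Kan complexes and pointed Kan pairs *)

Record pkan := PKan {
  pk_sset :> sset;
  pk_kan : kan pk_sset;
  pk_pt : pk_sset 0
}.

Record pkmap (K K' : pkan) := PKMap {
  pkm :> smap K K';
  pkm_pt : pkm 0 (pk_pt K) = pk_pt K'
}.

Record kanpair := KanPair {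
  total : sset;
  sub : subset total;
  total_kan : kan total;
  sub_kan : kan (sub_sset sub);
  bpt : total 0;
  bpt_sub : mem_sub sub bpt
}.

Record pairmap (P Q : kanpair) := PairMap {
  pm :> smap (total P) (total Q);
  pm_sub : forall n (x : total P n),
    mem_sub (sub P) x -> mem_sub (sub Q) (pm n x);
  pm_pt : pm 0 (bpt P) = bpt Q
}.

Definition pairK (P : kanpair) : pkan := PKan (@total_kan P) (bpt P).
Definition pairL (P : kanpair) : pkan :=
  @PKan (sub_sset (sub P)) (@sub_kan P) (exist _ (bpt P) (bpt_sub P)).

Definition pair_incl (P : kanpair) : pkmap (pairL P) (pairK P) :=
  @PKMap (pairL P) (pairK P) (sub_incl (sub P)) erefl.

Definition pmK P Q (f : pairmap P Q) : pkmap (pairK P) (pairK Q) :=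
  @PKMap (pairK P) (pairK Q) f (pm_pt f).

Definition pmL_fun P Q (f : pairmap P Q) n (x : pairL P n) : pairL Q n :=
  exist _ (f n (sval x)) (pm_sub f (svalP x)).

Definition pmL P Q (f : pairmap P Q) : pkmap (pairL P) (pairL Q).
Proof.
apply: (@PKMap (pairL P) (pairL Q)
  (@SMap (pairL P) (pairL Q) (pmL_fun f) _ _)).
- by move=> n i x; apply: sval_inj => /=; rewrite sfun_face.
- by move=> n i x; apply: sval_inj => /=; rewrite sfun_degen.
- by move=> ? ?; apply: sval_inj; exact: pm_pt.
Defined.

(* The degenerate image of the base point; see [s_star] and [d_star] below for
   its independence of the choice of degeneracies. *)
Fixpoint star (K : pkan) n : K n :=
  match n with 0 => pk_pt K | m.+1 => s 0 (star K m) end.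
Arguments star {K} n.

(** * Homotopy and the defining relations of the homotopy groups *)

Definition same_bdry (K : sset) n : K n -> K n -> Prop :=
  match n with
  | 0 => fun _ _ => True
  | m.+1 => fun x y => forall i, i <= m.+1 -> d i x = d i y
  end.

(* [s_(n-1) d_i x] for [n >= 1]; the value for [n = 0] is never used. *)
Definition sd (K : sset) n (i : nat) : K n -> K n :=
  match n with 0 => fun x => x | m.+1 => fun x => s m (d i x) end.

Definition homotopic (K : sset) n (x y : K n) : Prop :=
  same_bdry x y /\
  filled (fun i => if i < n then sd i x else if i == n then x else y).

Definition is_sphere (K : pkan) n : K n -> Prop :=
  match n with
  | 0 => fun _ => True
  | m.+1 => fun x => forall i, i <= m.+1 -> d i x = star m
  end.

Definition sphere (K : pkan) n := {x : K n | is_sphere x}.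

Definition sph_homotopic (K : pkan) n (x y : sphere K n) : Prop :=
  homotopic (sval x) (sval y).

(* For [n = m.+1 >= 1]: the tuple [(pt,...,pt,y,z,x)] is filled, i.e. [z] is a
   product [xy]. *)
Definition sph_mul (K : pkan) m (x y z : sphere K m.+1) : Prop :=
  filled (fun i => if i < m then star m.+1
                   else if i == m then sval y
                   else if i == m.+1 then sval z
                   else sval x).

(* Relative notions exist in dimension [n >= 1] only: here [n = m.+1]. That the
   filled tuple is a cycle is again automatic. *)
Definition rel_homotopic (P : kanpair) m (x y : pairK P m.+1) : Prop :=
  [/\ forall i, 1 <= i <= m.+1 -> d i x = d i y,
      mem_sub (sub P) (d 0 x), mem_sub (sub P) (d 0 y) &
      exists2 h : pairK P m.+1, mem_sub (sub P) h &
        filled (fun i => if i == 0 then h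
                         else if i < m.+1 then s m (d i x)
                         else if i == m.+1 then x else y)].

Definition is_rel_sphere (P : kanpair) m (x : pairK P m.+1) : Prop :=
  mem_sub (sub P) (d 0 x) /\ forall i, 1 <= i <= m.+1 -> d i x = star m.

Definition rel_sphere (P : kanpair) m := {x : pairK P m.+1 | is_rel_sphere x}.

Definition rel_sph_homotopic (P : kanpair) m (x y : rel_sphere P m) : Prop :=
  rel_homotopic (sval x) (sval y).

(* For [n = m.+2 >= 2]: the tuple [(h,pt,...,pt,y,z,x)] is filled for some [h]
   in [L_n], i.e. [z] is a relative product [xy]. *)
Definition rel_sph_mul (P : kanpair) m (x y z : rel_sphere P m.+1) : Prop :=
  exists2 h : pairK P m.+2, mem_sub (sub P) h &
    filled (fun i => if i == 0 then h
                     else if i < m.+1 then star m.+2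
                     else if i == m.+1 then sval y
                     else if i == m.+2 then sval z
                     else sval x).

(** * Quotients *)

Section Quotient.
Variables (T : Type) (R : T -> T -> Prop) (eR : Equivalence R).

Definition brel : rel {classic T} := fun x y => `[< R x y >].

Fact brel_refl : reflexive brel.
Proof. by move=> x; apply/asboolP; case: eR => r _ _; exact: r. Qed.
Fact brel_sym : symmetric brel.
Proof.
by move=> x y; apply/asboolP/asboolP; case: eR => _ h _; exact: h.
Qed.
Fact brel_trans : transitive brel.
Proof.
move=> y x z /asboolP xy /asboolP yz; apply/asboolP.
by case: eR => _ _ h; exact: (h x y z).
Qed.

Definition brel_equiv : equiv_rel {classic T} :=
  EquivRel brel brel_refl brel_sym brel_trans.

Definition quot := {eq_quot brel_equiv}.

Definition cls (x : T) : quot := \pi_quot (x : {classic T}).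
Definition rep (a : quot) : T := repr a.

Lemma repK a : cls (rep a) = a. Proof. exact: reprK. Qed.

Lemma clsP x y : cls x = cls y <-> R x y.
Proof.
split=> [/eqmodP/asboolP //|xy]; exact/eqmodP/asboolP.
Qed.

Lemma cls_ind (Q : quot -> Prop) : (forall x, Q (cls x)) -> forall a, Q a.
Proof. by move=> h a; rewrite -(repK a). Qed.

Definition qlift (U : Type) (f : T -> U) (_ : forall x y, R x y -> f x = f y) :
  quot -> U := fun a => f (rep a).

Lemma qliftE U (f : T -> U) (hf : forall x y, R x y -> f x = f y) x :
  qlift hf (cls x) = f x.
Proof. by apply: hf; apply/clsP; rewrite repK. Qed.
End Quotient.

(* A ternary relation [M x y z] ("[z] is a product of [x] and [y]") with
   divisions and the associativity law below turns the quotient by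
   [x ~ y <-> M y e x] into a group. *)
Section GroupFromRelation.
Variables (T : Type) (R : T -> T -> Prop) (M : T -> T -> T -> Prop) (e : T).

Record is_mulrel : Prop := IsMulrel {
  mr_R : forall x y, R x y <-> M y e x;
  mr_1r : forall x, M x e x;
  mr_1l : forall x, M e x x;
  mr_mul : forall x y, exists z, M x y z;
  mr_divl : forall y z, exists x, M x y z;
  mr_divr : forall x z, exists y, M x y z;
  mr_assoc : forall a b c x f g,
    M c a b -> M g c f -> M f a x <-> M g b x;
  mr_assoc1 : forall a b c x f g,
    M c a b -> M f a x -> M g b x -> M g c f;
}.

Hypothesis mr : is_mulrel.

Lemma mr_equiv : Equivalence R.
Proof.
case: mr => RM r1 l1 _ _ _ as1 as2.
have ref x : R x x by apply/RM.
have euc x y z : R x y -> R x z -> R y z.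
  by move=> /RM xy /RM xz; apply/RM; apply: (as2 _ _ _ _ _ _ (r1 e) xy xz).
by split; [exact: ref|move=> x y /euc; apply|move=> x y z xy;
  exact: (euc _ _ _ (euc _ _ _ xy (ref x)))].
Qed.

Lemma mr_wd x x' y y' z z' :
  R x x' -> R y y' -> M x y z -> M x' y' z' -> R z z'.
Proof.
case: mr => RM r1 l1 _ _ _ as1 as2.
move=> /RM xx' /RM yy' xyz xyz'.
have x'yz : M x' y z by apply/(as1 y y e z x x' (l1 y) xx').
by apply/RM; apply: (proj2 (as1 _ _ _ _ _ _ yy' xyz') x'yz).
Qed.

Variable eR : Equivalence R.
Local Notation Q := (quot eR).
Local Notation C := (cls eR).

Definition qmul (a b : Q) : Q := C (sval (cid (mr_mul mr (rep a) (rep b)))).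
Definition qinv (a : Q) : Q := C (sval (cid (mr_divl mr (rep a) e))).

Lemma qmulE x y z : M x y z -> qmul (C x) (C y) = C z.
Proof.
move=> xyz; rewrite /qmul; case: cid => z' /= h; apply/clsP.
by apply: mr_wd h xyz; apply/(clsP eR); rewrite repK.
Qed.

Lemma qmulA : associative qmul.
Proof.
elim/cls_ind=> g; elim/cls_ind=> c; elim/cls_ind=> a.
have [b cab] := mr_mul mr c a; have [f gcf] := mr_mul mr g c.
have [x fax] := mr_mul mr f a.
rewrite (qmulE cab) (qmulE gcf) (qmulE fax).
by apply: qmulE; apply/(mr_assoc mr _ cab gcf).
Qed.

Lemma qmul1 : left_id (C e) qmul.
Proof. by elim/cls_ind=> x; exact/qmulE/(mr_1l mr). Qed.

Lemma qmulr1 : right_id (C e) qmul.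
Proof. by elim/cls_ind=> x; exact/qmulE/(mr_1r mr). Qed.

Lemma qmulV : left_inverse (C e) qinv qmul.
Proof.
move=> a; rewrite -[X in qmul _ X]repK /qinv; case: cid => x /= h.
exact: qmulE.
Qed.

Lemma qmulVr : right_inverse (C e) qinv qmul.
Proof.
move=> a; rewrite -[LHS]qmul1 -{1}(qmulV (qinv a)) -qmulA.
by rewrite (qmulA (qinv a)) qmulV qmul1 qmulV.
Qed.
End GroupFromRelation.

(** * Simplicial calculus *)

Section Calculus.
Variable K : sset.
Implicit Types (n i j k : nat).

Lemma dd n i j (x : K n.+2) : i < j <= n.+2 -> d i (d j x) = d j.-1 (d i x).
Proof. exact: face_face. Qed.
Lemma ds_lt n i j (x : K n.+1) :
  i < j <= n.+1 -> d i (s j x) = s j.-1 (d i x).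
Proof. exact: face_degen_lt. Qed.
Lemma ds_eq n j (x : K n) : j <= n -> d j (s j x) = x.
Proof. exact: face_degen_eq. Qed.
Lemma ds_eqS n j (x : K n) : j <= n -> d j.+1 (s j x) = x.
Proof. exact: face_degen_eqS. Qed.
Lemma ds_gt n i j (x : K n.+1) :
  j.+1 < i <= n.+2 -> d i (s j x) = s j (d i.-1 x).
Proof. exact: face_degen_gt. Qed.
Lemma ss n i j (x : K n) : i <= j <= n -> s i (s j x) = s j.+1 (s i x).
Proof. exact: degen_degen. Qed.

Lemma filled_ext n (t t' : nat -> K n) :
  (forall i, i <= n.+1 -> t i = t' i) -> filled t <-> filled t'.
Proof.
by move=> tt'; split=> -[w h]; exists w => i le; rewrite h ?tt'.
Qed.
End Calculus.

Section MapCalculus.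
Variables (K K' : sset) (f : smap K K').
Lemma sfun_d n i (x : K n.+1) : f n (d i x) = d i (f n.+1 x).
Proof. exact: sfun_face. Qed.
Lemma sfun_s n i (x : K n) : f n.+1 (s i x) = s i (f n x).
Proof. exact: sfun_degen. Qed.

Lemma filled_map n (t : nat -> K n) :
  filled t -> filled (fun i => f n (t i)).
Proof. by case=> w h; exists (f _ w) => i le; rewrite -sfun_d h. Qed.

Lemma sfun_sd n i (x : K n) : f n (sd i x) = sd i (f n x).
Proof. by case: n x => //= n x; rewrite sfun_s sfun_d. Qed.

Lemma homotopic_map n (x y : K n) :
  homotopic x y -> homotopic (f n x) (f n y).
Proof.
case=> xy /filled_map h; split.
  case: n x y xy {h} => //= n x y xy i le.
  by rewrite -!sfun_d xy.
apply: (proj1 (filled_ext _) h) => i _ /=.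
by case: ifP => _; [rewrite sfun_sd|case: ifP].
Qed.
End MapCalculus.

Section Star.
Variable K : pkan.
Lemma s_star n i : i <= n -> s i (star n : K n) = star n.+1.
Proof.
elim: n i => [|n IH] [|i] //= le.
by rewrite -ss // IH.
Qed.

Lemma d_star n i : i <= n.+1 -> d i (star n.+1 : K n.+1) = star n.
Proof.
case: i => [|i] le; first by rewrite /= ds_eq.
by rewrite -(@s_star n i le) ds_eqS.
Qed.

Lemma star_sphere n : is_sphere (star n : K n).
Proof. by case: n => // n i; apply: d_star. Qed.

Definition star_sph n : sphere K n := exist _ (star n) (@star_sphere n).
End Star.

Lemma pkm_star (K K' : pkan) (f : pkmap K K') n : f n (star n) = star n.
Proof.
by elim: n => [|n IH] /=; [exact: pkm_pt|rewrite sfun_s IH].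
Qed.

Lemma pkm_sphere (K K' : pkan) (f : pkmap K K') n (x : K n) :
  is_sphere x -> is_sphere (f n x).
Proof.
case: n x => //= n x h i le.
by rewrite -sfun_d h // pkm_star.
Qed.

(** * The absolute homotopy groups *)

Section SphereLaws.
Variables (K : pkan) (m : nat).

Lemma sphere_horn (t : nat -> K m.+1) k : k <= m.+2 ->
  (forall i, i <= m.+2 -> i != k -> is_sphere (t i)) ->
  exists2 w : K m.+2, forall i, i <= m.+2 -> i != k -> d i w = t i &
    is_sphere (d k w).
Proof.
move=> km ts; have [||w hw] := @pk_kan K m.+1 k t => //.
  move=> i j /andP[ij jm] ik jk.
  by rewrite !ts //; lia.
exists w => // i im; case: (ltnP i k) => ik.
  by rewrite dd ?hw ?ts //; lia.
by rewrite -[i]/(i.+1.-1) -dd ?hw ?ts //; lia.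
Qed.

(* The faces of an (m+3)-simplex whose faces are trivial in the positions
   below [m]; [v p q] is the common face of the faces [m+p] and [m+q]. *)
Let face4 (v : nat -> nat -> K m.+1) p i :=
  if i < m then star m.+1
  else if i - m < p then v (i - m) p else v p (i - m).+1.

Lemma filled4 (v : nat -> nat -> K m.+1) k : k <= 3 ->
  (forall p, p <= 3 -> p != k -> filled (face4 v p)) -> filled (face4 v k).
Proof.
move=> k3 fill.
have [p|w hw] := @choice _ _ (fun p (w : K m.+2) => p <= 3 -> p != k ->
    forall i, i <= m.+2 -> d i w = face4 v p i).
  case: (boolP ((p <= 3) && (p != k))) => [/andP[p3 pk]|np].
    by have [w hw] := fill p p3 pk; exists w.
  by exists (star m.+2) => p3 pk; rewrite p3 pk in np.
pose t i : K m.+2 := if i < m then star m.+2 else w (i - m).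
have [||W hW] := @pk_kan K m.+2 (m + k) t; first lia.
  move=> i j /andP[ij jm] ik jk; rewrite /t.
  case: (ltnP i m) => im.
    rewrite (@d_star _ _ j.-1); last lia.
    case: (ltnP j m) => jm'; first by rewrite d_star //; lia.
    by rewrite hw ?/face4 ?im //; lia.
  rewrite ifF; last lia.
  rewrite !hw ?/face4; try lia.
  rewrite ifF; last lia.
  rewrite ifT; last lia.
  rewrite ifF; last lia.
  rewrite ifF; last lia.
  by congr (v _ _); lia.
exists (d (m + k) W) => i im; case: (ltnP i (m + k)) => ik.
  rewrite dd ?hW /t ?/face4; try lia.
  case: (ltnP i m) => im'; first by rewrite d_star //; lia.
  rewrite hw /face4; try lia.
  rewrite ifF; last lia.
  rewrite ifF; last lia.
  rewrite ifT; last lia.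
  by congr (v _ _); lia.
rewrite -[i in LHS]/(i.+1.-1) -dd; last lia.
rewrite hW /t; try lia.
rewrite ifF; last lia.
rewrite hw /face4; try lia.
rewrite ifF; last lia.
rewrite ifT; last lia.
rewrite !ifF; try lia.
by congr (v _ _); lia.
Qed.

Lemma sph_mul4 (a b c e f g : sphere K m.+1) :
  [/\ sph_mul f a e -> sph_mul g b e -> sph_mul g c f -> sph_mul c a b,
      sph_mul c a b -> sph_mul g b e -> sph_mul g c f -> sph_mul f a e,
      sph_mul c a b -> sph_mul f a e -> sph_mul g c f -> sph_mul g b e &
      sph_mul c a b -> sph_mul f a e -> sph_mul g b e -> sph_mul g c f].
Proof.
pose v i j : K m.+1 := if i == 0 then
    (if j == 1 then sval a else if j == 2 then sval b else sval c)
  else if i == 1 then (if j == 2 then sval e else sval f) else sval g.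
have E p x y z : (forall i, i <= m.+2 -> face4 v p i =
    (if i < m then star m.+1 else if i == m then sval y
     else if i == m.+1 then sval z else sval x)) ->
  filled (face4 v p) <-> sph_mul x y z.
  exact: filled_ext.
have solve i : i <= m.+2 -> [\/ i < m, i = m, i = m.+1 | i = m.+2].
  move=> im; case: (ltnP i m) => im'; first by constructor 1.
  have : [|| i == m, i == m.+1 | i == m.+2] by lia.
  by case/or3P => /eqP ->; [constructor 2|constructor 3|constructor 4].
have e0 : m - m = 0 by lia.
have e1 : m.+1 - m = 1 by lia.
have e2 : m.+2 - m = 2 by lia.
have n1 : (m.+1 < m) = false by lia.
have n2 : (m.+2 < m) = false by lia.
have n3 : (m.+1 == m) = false by lia.
have n4 : (m.+2 == m) = false by lia.
have n5 : (m.+2 == m.+1) = false by lia.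
pose S := (e0, e1, e2, n1, n2, n3, n4, n5, ltnn, eqxx).
have E0 : filled (face4 v 0) <-> sph_mul c a b.
  by apply: E => // i /solve[im|->|->|->]; rewrite /face4 ?S ?im.
have E1 : filled (face4 v 1) <-> sph_mul f a e.
  by apply: E => // i /solve[im|->|->|->]; rewrite /face4 ?S ?im.
have E2 : filled (face4 v 2) <-> sph_mul g b e.
  by apply: E => // i /solve[im|->|->|->]; rewrite /face4 ?S ?im.
have E3 : filled (face4 v 3) <-> sph_mul g c f.
  by apply: E => // i /solve[im|->|->|->]; rewrite /face4 ?S ?im.
by split => /[dup] h1 ? h2 h3;
  [apply/E0|apply/E1|apply/E2|apply/E3]; apply: filled4 => //;
  case=> [|[|[|[]]]] // _ _;
  [apply/E1|apply/E2|apply/E3|apply/E0|apply/E2|apply/E3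
  |apply/E0|apply/E1|apply/E3|apply/E0|apply/E1|apply/E2].
Qed.

Lemma sph_homotopicE (x y : sphere K m.+1) :
  sph_homotopic x y <-> sph_mul y (star_sph K m.+1) x.
Proof.
have [hx hy] := (svalP x, svalP y).
rewrite /sph_homotopic /homotopic /sph_mul /=.
have -> : filled (fun i => if i < m.+1 then s m (d i (sval x))
    else if i == m.+1 then sval x else sval y)
  <-> filled (fun i => if i < m then star m.+1
    else if i == m then star m.+1 else if i == m.+1 then sval x else sval y).
  apply: filled_ext => i _.
  case: (ltnP i m.+1) => im.
    rewrite hx ?s_star //; last lia.
    by case: ifP => // im'; rewrite ifT //; lia.
  rewrite [in RHS]ifF; last lia.
  by rewrite [in RHS]ifF //; lia.
by split=> [[]//|h]; split=> // i im; rewrite hx // hy.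
Qed.

Lemma sph_mulrel : is_mulrel (@sph_homotopic K m.+1) (@sph_mul K m)
  (star_sph K m.+1).
Proof.
have div (t : nat -> K m.+1) k : k <= m.+2 ->
    (forall i, is_sphere (t i)) ->
    exists u : sphere K m.+1, filled (fun i => if i == k then sval u else t i).
  move=> km ts; have [w hw hk] := sphere_horn km (fun i _ _ => ts i).
  exists (exist _ _ hk), w => i im /=.
  by case: eqP => [->//|/eqP ik]; rewrite hw.
have st : is_sphere (star m.+1 : K m.+1) := @star_sphere K m.+1.
split.
- exact: sph_homotopicE.
- move=> x; have hx := svalP x; exists (s m.+1 (sval x)) => i im /=.
  case: (ltnP i m) => im'.
    by rewrite ds_lt ?hx ?s_star //; lia.
  case: eqP => [->|?].
    by rewrite ds_lt ?hx ?s_star //; lia.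
  case: eqP => [->|?]; first by rewrite ds_eq.
  have -> : i = m.+2 by lia.
  by rewrite ds_eqS.
- move=> x; have hx := svalP x; exists (s m (sval x)) => i im /=.
  case: (ltnP i m) => im'.
    by rewrite ds_lt ?hx ?s_star //; lia.
  case: eqP => [->|?]; first by rewrite ds_eq.
  case: eqP => [->|?]; first by rewrite ds_eqS.
  have -> : i = m.+2 by lia.
  by rewrite ds_gt /= ?hx ?s_star //; lia.
- move=> x y; pose t i := if i < m then star m.+1
    else if i == m then sval y else sval x.
  have [|i|u hu] := div t m.+1; first by lia.
    by rewrite /t; case: ifP => // _; case: ifP => _; apply: svalP.
  exists u; apply: (proj1 (filled_ext _) hu) => i _; rewrite /t.
  case: (ltnP i m) => im; first by rewrite ifF //; lia.
  by case: (i =P m) => [->|_]; [rewrite ifF //; lia|].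
- move=> y z; pose t i := if i < m then star m.+1
    else if i == m then sval y else sval z.
  have [|i|u hu] := div t m.+2; first by lia.
    by rewrite /t; case: ifP => // _; case: ifP => _; apply: svalP.
  exists u; apply: (proj1 (filled_ext _) hu) => i im; rewrite /t.
  case: (i =P m.+2) => [->|?]; first by rewrite !ifF //; lia.
  case: ifP => // ?; case: ifP => // ?.
  by rewrite ifT //; lia.
- move=> x z; pose t i := if i < m then star m.+1
    else if i == m.+1 then sval z else sval x.
  have [|i|u hu] := div t m; first by lia.
    by rewrite /t; case: ifP => // _; case: ifP => _; apply: svalP.
  exists u; apply: (proj1 (filled_ext _) hu) => i im; rewrite /t.
  case: (i =P m) => [->|//]; by rewrite ltnn.
- move=> a b c x f g cab gcf; have [_ h1 h2 _] := sph_mul4 a b c x f g.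
  by split; [move=> fax; exact: h2|move=> gbx; exact: h1].
- move=> a b c x f g; by have [] := sph_mul4 a b c x f g.
Qed.
End SphereLaws.

Lemma sph_homotopic_equiv (K : pkan) n : Equivalence (@sph_homotopic K n).
Proof.
case: n => [|m]; last exact: mr_equiv (sph_mulrel K m).
have ref (x : sphere K 0) : sph_homotopic x x.
  split=> //; exists (s 0 (sval x)) => -[|[|i]] // _.
    exact: ds_eq.
  exact: ds_eqS.
have euc (x y z : sphere K 0) :
    sph_homotopic x y -> sph_homotopic x z -> sph_homotopic y z.
  move=> [_ [v hv]] [_ [w hw]]; split=> //.
  have [//||W hW] := @pk_kan K 1 2 (fun i => if i == 0 then v else w).
    move=> i j ij _ j2; have [-> ->] : i = 0 /\ j = 1 by lia.
    by rewrite /= (hv 0) // (hw 0).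
  exists (d 2 W) => -[|[|i]] //= _.
    by rewrite dd // hW // (hv 1).
  by rewrite dd // hW // (hw 1).
split; [exact: ref|move=> x y /euc; apply; exact: ref|].
by move=> x y z xy; apply: (euc _ _ _ (euc _ _ _ xy (ref x))).
Qed.

Definition pi (K : pkan) n := quot (sph_homotopic_equiv K n).
Definition pi_cls (K : pkan) n (x : sphere K n) : pi K n := cls _ x.
Definition pi_base (K : pkan) n : pi K n := pi_cls (star_sph K n).

HB.instance Definition _ (K : pkan) n :=
  Choice.copy (pi K n) (quot (sph_homotopic_equiv K n)).

HB.instance Definition _ (K : pkan) n := isGroup.Build (pi K n.+1)
  (@qmulA _ _ _ _ (sph_mulrel K n) (sph_homotopic_equiv K n.+1))
  (@qmul1 _ _ _ _ (sph_mulrel K n) (sph_homotopic_equiv K n.+1))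
  (@qmulr1 _ _ _ _ (sph_mulrel K n) (sph_homotopic_equiv K n.+1))
  (@qmulV _ _ _ _ (sph_mulrel K n) (sph_homotopic_equiv K n.+1))
  (@qmulVr _ _ _ _ (sph_mulrel K n) (sph_homotopic_equiv K n.+1)).

Lemma pi_ind (K : pkan) n (Q : pi K n -> Prop) :
  (forall x : sphere K n, Q (pi_cls x)) -> forall a, Q a.
Proof. exact: cls_ind. Qed.

Lemma pi_clsP (K : pkan) n (x y : sphere K n) :
  pi_cls x = pi_cls y <-> sph_homotopic x y.
Proof. exact: clsP. Qed.

Lemma pi_mulE (K : pkan) n (x y z : sphere K n.+1) :
  sph_mul x y z -> (pi_cls x * pi_cls y)%g = pi_cls z.
Proof. exact: qmulE. Qed.

Lemma pi_1E (K : pkan) n : 1%g = pi_base K n.+1.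
Proof. by []. Qed.

(** * The relative homotopy groups *)

(* [fiber P] consists of the simplices [x] of [K] whose 0-th vertex is the
   base point and whose 0-th face is in [L], with dimension and all indices
   shifted by one. It is a Kan complex, and its absolute homotopy groups are
   the relative ones of [P]; it is only used to transfer to the relative case
   the laws proved above. *)
Section Fiber.
Variable P : kanpair.
Local Notation K := (pairK P).
Local Notation L := (sub P).

Fixpoint vertex0 n : K n -> K 0 :=
  match n return K n -> K 0 with
  | 0 => id
  | m.+1 => fun x => vertex0 (d m.+1 x)
  end.

Lemma vertex0_d n i (x : K n.+1) :
  i <= n -> vertex0 (d i.+1 x) = vertex0 x.
Proof.
elim: n i x => [|n IH] i x im.
  by have -> : i = 0 by lia.
have [->//|ni] := eqVneq i n.+1.
rewrite -[RHS]/(vertex0 (d n.+2 x)) -(IH i (d n.+2 x)); last lia.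
by rewrite dd //; lia.
Qed.

Lemma vertex0_star n : vertex0 (star n) = bpt P.
Proof.
elim: n => [//|n IH]; by rewrite -[LHS]/(vertex0 (d n.+1 (star n.+1))) d_star.
Qed.

Lemma subL_d n i (x : K n.+1) : mem_sub L x -> mem_sub L (d i x).
Proof. exact: mem_face. Qed.
Lemma subL_s n i (x : K n) : mem_sub L x -> mem_sub L (s i x).
Proof. exact: mem_degen. Qed.
Lemma subL_star n : mem_sub L (star n : K n).
Proof. by elim: n => [|n]; [exact: bpt_sub|exact: subL_s]. Qed.

Definition in_fiber n (x : K n.+1) := vertex0 x = bpt P /\ mem_sub L (d 0 x).
Definition fiber_cell n := {x : K n.+1 | in_fiber x}.

Lemma in_fiber_d n i (x : K n.+2) :
  i <= n.+1 -> in_fiber x -> in_fiber (d i.+1 x).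
Proof.
move=> im [vx Lx]; split; first by rewrite vertex0_d.
by rewrite dd //; exact: subL_d.
Qed.

Lemma in_fiber_s n i (x : K n.+1) : i <= n -> in_fiber x -> in_fiber (s i.+1 x).
Proof.
move=> im [vx Lx]; split; last by rewrite ds_lt //; exact: subL_s.
by rewrite -(@vertex0_d _ i) ?ds_eq //; lia.
Qed.

Definition fiber_face n (i : 'I_n.+2) (x : fiber_cell n.+1) : fiber_cell n :=
  exist _ (d i.+1 (sval x)) (@in_fiber_d n i _ (ltn_ord i) (svalP x)).
Definition fiber_degen n (i : 'I_n.+1) (x : fiber_cell n) : fiber_cell n.+1 :=
  exist _ (s i.+1 (sval x)) (@in_fiber_s n i _ (ltn_ord i) (svalP x)).

Definition fiber_sset : sset.
Proof.
apply: (@SSet fiber_cell fiber_face fiber_degen).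
- move=> n i j x /andP[ij jn]; apply: sval_inj => /=.
  rewrite !inordK; try lia.
  by rewrite dd; [rewrite prednK //; lia|lia].
- move=> n i j x /andP[ij jn]; apply: sval_inj => /=.
  rewrite !inordK; try lia.
  by rewrite ds_lt; [rewrite prednK //; lia|lia].
- move=> n j x jn; apply: sval_inj => /=.
  by rewrite !inordK ?ds_eq //; lia.
- move=> n j x jn; apply: sval_inj => /=.
  by rewrite !inordK ?ds_eqS //; lia.
- move=> n i j x /andP[ij jn]; apply: sval_inj => /=.
  rewrite !inordK; try lia.
  by rewrite ds_gt; [rewrite prednK //; lia|lia].
- move=> n i j x /andP[ij jn]; apply: sval_inj => /=.
  rewrite !inordK; try lia.
  by rewrite ss //; lia.
Defined.

Lemma fiber_dE n i (x : fiber_sset n.+1) :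
  i <= n.+1 -> sval (d i x) = d i.+1 (sval x).
Proof. by move=> im; rewrite /= inordK. Qed.

Lemma fiber_sE n i (x : fiber_sset n) :
  i <= n -> sval (s i x) = s i.+1 (sval x).
Proof. by move=> im; rewrite /= inordK. Qed.

Lemma fiber_kan : kan fiber_sset.
Proof.
move=> n k t kn ht.
have hK i j : i < j <= n.+1 -> i != k -> j != k ->
    d i.+1 (sval (t j)) = d j (sval (t i)).
  move=> ij ik jk; case: n t kn ht ij => [|n] t kn ht ij; first lia.
  have /(congr1 sval) := ht i j ij ik jk.
  rewrite !fiber_dE; try lia.
  by move=> ->; congr (d _ _); lia.
pose y i : pairL P n := exist _ (d 0 (sval (t i))) (proj2 (svalP (t i))).
have hy : horn k y.
  rewrite {}/y; case: n t kn ht hK => //= n t kn ht hK i j ij ik jk.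
  apply: sval_inj => /=; rewrite -![face (inord _) _]/(d _ _).
  transitivity (d 0 (d i.+1 (sval (t j)))); first by rewrite [RHS]dd //; lia.
  by rewrite hK // [LHS]dd //; lia.
have [u hu] := sub_kan kn hy.
have {}hu i : i <= n.+1 -> i != k -> d i (sval u) = d 0 (sval (t i)).
  by move=> im ik; rewrite -[RHS]/(sval (y i)) -hu.
have [|[|i] [|j] //= ij ik jk|w hw] :=
  @total_kan P n.+1 k.+1 (fun i => if i is i'.+1 then sval (t i') else sval u).
- lia.
- by rewrite hu //; lia.
- by rewrite hK //; lia.
have wfib : in_fiber w.
  split; last by rewrite hw //; exact: (svalP u).
  pose i := if k == 0 then 1 else 0.
  have [im ik] : i <= n.+1 /\ i != k by rewrite /i; case: eqP; lia.
  rewrite -(@vertex0_d _ i) // (hw i.+1) //.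
  by case: (svalP (t i)).
exists (exist _ w wfib) => i im ik; apply: sval_inj.
by rewrite fiber_dE //= hw.
Qed.

Lemma star_in_fiber n : in_fiber (star n.+1 : K n.+1).
Proof. by split; [exact: vertex0_star|rewrite d_star //; exact: subL_star]. Qed.

Definition fiber : pkan :=
  @PKan fiber_sset fiber_kan (exist _ _ (star_in_fiber 0)).

Lemma fiber_star n : sval (star n : fiber n) = star n.+1.
Proof.
elim: n => [//|n IH]; rewrite [star _]/= (@fiber_sE _ 0) // IH.
exact: (@s_star K).
Qed.

Lemma rel_sphere_fiber n (x : rel_sphere P n) : in_fiber (sval x).
Proof.
case: x => x /= [Lx hx]; split => //.
by rewrite -(@vertex0_d _ n) // hx ?vertex0_star //; lia.
Qed.

Definition to_fiber n (x : rel_sphere P n) : fiber n :=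
  exist _ (sval x) (rel_sphere_fiber x).

Lemma to_fiber_sphere n (x : rel_sphere P n) : is_sphere (to_fiber x).
Proof.
case: n x => // n x i im; apply: sval_inj.
by rewrite fiber_dE // fiber_star /=; case: (svalP x) => _ ->.
Qed.

Definition fib n (x : rel_sphere P n) : sphere fiber n :=
  exist _ (to_fiber x) (to_fiber_sphere x).

Lemma of_fiber_sphere n (x : sphere fiber n) : is_rel_sphere (sval (sval x)).
Proof.
case: x => -[x [vx Lx]] hx; split=> //= i.
case: n x vx Lx hx => [|n] x vx Lx hx /andP[i0 im].
  by have -> : i = 1 by lia.
have -> : i = i.-1.+1 by lia.
have /(_ i.-1)/(_ _)/(congr1 sval) := hx.
rewrite fiber_dE ?fiber_star /=; try lia.
by apply; lia.
Qed.

Definition unfib n (x : sphere fiber n) : rel_sphere P n :=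
  exist _ (sval (sval x)) (of_fiber_sphere x).

Lemma unfibK n (x : sphere fiber n) : fib (unfib x) = x.
Proof. by do 2!apply: sval_inj. Qed.

Lemma fib_filled n (t : nat -> fiber n) (t' : nat -> K n.+1) :
  (forall i, i <= n.+1 -> sval (t i) = t' i.+1) ->
  filled t <->
  exists2 h, mem_sub L h & filled (fun i => if i == 0 then h else t' i).
Proof.
move=> tt'; split=> [[w hw]|[h Lh [w hw]]].
  exists (d 0 (sval w)); first by case: (svalP w).
  exists (sval w) => -[|i] im //=.
  by rewrite -tt' // -hw // fiber_dE.
have wfib : in_fiber w.
  split; last by rewrite hw.
  rewrite -(@vertex0_d _ 0) // hw //= -tt' //.
  by case: (svalP (t 0)).
exists (exist _ w wfib) => i im; apply: sval_inj.
by rewrite fiber_dE //= hw //= tt'.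
Qed.

Lemma fib_homotopic n (x y : rel_sphere P n) :
  rel_sph_homotopic x y <-> sph_homotopic (fib x) (fib y).
Proof.
have [[Lx hx] [Ly hy]] := (svalP x, svalP y).
rewrite /sph_homotopic /homotopic (@fib_filled _ _
  (fun i => if i < n.+1 then s n (d i (sval x))
            else if i == n.+1 then sval x else sval y)); last first.
  move=> i im; rewrite ltnS eqSS.
  case: ltnP => in'; last by case: ifP.
  case: n x y Lx hx Ly hy im in' => //= n x y Lx hx Ly hy im in'.
  by rewrite !inordK //; lia.
split=> [[_ _ _ h]|[_ h]]; last first.
  by split=> // i im; rewrite hx // hy.
split=> //; case: n x y Lx hx Ly hy h => //= n x y Lx hx Ly hy _ i im.
by apply: sval_inj; rewrite !fiber_dE //= hx // hy.
Qed.

Lemma fib_mul n (x y z : rel_sphere P n.+1) :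
  rel_sph_mul x y z <-> sph_mul (fib x) (fib y) (fib z).
Proof.
rewrite /sph_mul (@fib_filled _ _
  (fun i => if i < n.+1 then star n.+2 else if i == n.+1 then sval y
            else if i == n.+2 then sval z else sval x)) //.
move=> i im; rewrite ltnS !eqSS.
by case: ifP => _; [exact: fiber_star|case: ifP => // _; case: ifP].
Qed.

Lemma rel_star_sphere n : is_rel_sphere (star n.+1 : K n.+1).
Proof.
split; first by rewrite d_star //; exact: subL_star.
by move=> i /andP[_ im]; rewrite d_star.
Qed.

Definition rel_star_sph n : rel_sphere P n := exist _ _ (@rel_star_sphere n).

Lemma fib_star n : fib (rel_star_sph n) = star_sph fiber n.
Proof. by do 2!apply: sval_inj; rewrite fiber_star. Qed.

Lemma rel_sph_homotopic_equiv n : Equivalence (@rel_sph_homotopic P n).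
Proof.
have [r sy tr] := sph_homotopic_equiv fiber n.
split.
- by move=> x; apply/fib_homotopic; exact: r.
- by move=> x y /fib_homotopic xy; apply/fib_homotopic; exact: sy.
- move=> x y z /fib_homotopic xy /fib_homotopic yz.
  by apply/fib_homotopic; exact: tr xy yz.
Qed.

Lemma rel_sph_mulrel n : is_mulrel (@rel_sph_homotopic P n.+1)
  (@rel_sph_mul P n) (rel_star_sph n.+1).
Proof.
have [RM r1 l1 mu dl dr as0 as1] := sph_mulrel fiber n.
split.
- by move=> x y; rewrite fib_homotopic fib_mul fib_star.
- by move=> x; rewrite fib_mul fib_star.
- by move=> x; rewrite fib_mul fib_star.
- move=> x y; have [z] := mu (fib x) (fib y).
  by rewrite -(unfibK z) -fib_mul; exists (unfib z).
- move=> y z; have [x] := dl (fib y) (fib z).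
  by rewrite -(unfibK x) -fib_mul; exists (unfib x).
- move=> x z; have [y] := dr (fib x) (fib z).
  by rewrite -(unfibK y) -fib_mul; exists (unfib y).
- by move=> a b c x f g; rewrite !fib_mul; exact: as0.
- by move=> a b c x f g; rewrite !fib_mul; exact: as1.
Qed.
End Fiber.

(* [pi_rel P m] is the relative homotopy set of dimension [m.+1]. *)
Definition pi_rel (P : kanpair) m := quot (rel_sph_homotopic_equiv P m).
Definition pi_rel_cls (P : kanpair) m (x : rel_sphere P m) : pi_rel P m :=
  cls _ x.
Definition pi_rel_base (P : kanpair) m : pi_rel P m :=
  pi_rel_cls (rel_star_sph P m).

HB.instance Definition _ (P : kanpair) m :=
  Choice.copy (pi_rel P m) (quot (rel_sph_homotopic_equiv P m)).
HB.instance Definition _ (P : kanpair) n := isGroup.Build (pi_rel P n.+1)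
  (@qmulA _ _ _ _ (rel_sph_mulrel P n) (rel_sph_homotopic_equiv P n.+1))
  (@qmul1 _ _ _ _ (rel_sph_mulrel P n) (rel_sph_homotopic_equiv P n.+1))
  (@qmulr1 _ _ _ _ (rel_sph_mulrel P n) (rel_sph_homotopic_equiv P n.+1))
  (@qmulV _ _ _ _ (rel_sph_mulrel P n) (rel_sph_homotopic_equiv P n.+1))
  (@qmulVr _ _ _ _ (rel_sph_mulrel P n) (rel_sph_homotopic_equiv P n.+1)).

Lemma pi_rel_ind (P : kanpair) m (Q : pi_rel P m -> Prop) :
  (forall x : rel_sphere P m, Q (pi_rel_cls x)) -> forall a, Q a.
Proof. exact: cls_ind. Qed.

Lemma pi_rel_clsP (P : kanpair) m (x y : rel_sphere P m) :
  pi_rel_cls x = pi_rel_cls y <-> rel_sph_homotopic x y.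
Proof. exact: clsP. Qed.

Lemma pi_rel_mulE (P : kanpair) n (x y z : rel_sphere P n.+1) :
  rel_sph_mul x y z -> (pi_rel_cls x * pi_rel_cls y)%g = pi_rel_cls z.
Proof. exact: qmulE. Qed.

Lemma pi_rel_1E (P : kanpair) n : 1%g = pi_rel_base P n.+1.
Proof. by []. Qed.

(** * Induced maps *)

Definition sph_map (K K' : pkan) (f : pkmap K K') n (x : sphere K n) :
  sphere K' n := exist _ (f n (sval x)) (pkm_sphere f (svalP x)).

Lemma pi_map_wd (K K' : pkan) (f : pkmap K K') n (x y : sphere K n) :
  sph_homotopic x y -> pi_cls (sph_map f x) = pi_cls (sph_map f y).
Proof. by move=> h; apply/pi_clsP; exact: homotopic_map h. Qed.

Definition pi_map (K K' : pkan) (f : pkmap K K') n : pi K n -> pi K' n :=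
  qlift (@pi_map_wd K K' f n).

Lemma pi_mapE (K K' : pkan) (f : pkmap K K') n (x : sphere K n) :
  pi_map f (pi_cls x) = pi_cls (sph_map f x).
Proof. exact: qliftE. Qed.

Lemma pi_mapM (K K' : pkan) (f : pkmap K K') n :
  {morph @pi_map K K' f n.+1 : a b / (a * b)%g}.
Proof.
elim/pi_ind=> x; elim/pi_ind=> y.
have [z h] := mr_mul (sph_mulrel K n) x y.
have fh : sph_mul (sph_map f x) (sph_map f y) (sph_map f z).
  apply: (proj1 (filled_ext _) (filled_map f h)) => i _ /=.
  by case: ifP => _; [exact: (pkm_star f n.+1)|case: ifP => // _; case: ifP].
by rewrite (pi_mulE h) !pi_mapE (pi_mulE fh).
Qed.

Section PairMap.
Variables (P Q : kanpair) (f : pairmap P Q).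

Lemma rel_sphere_map n (x : pairK P n.+1) :
  is_rel_sphere x -> is_rel_sphere (f n.+1 x : pairK Q n.+1).
Proof.
case=> Lx hx; split; first by rewrite -sfun_d; exact: pm_sub.
by move=> i im; rewrite -sfun_d hx //; exact: (pkm_star (pmK f)).
Qed.

Definition rel_sph_map n (x : rel_sphere P n) : rel_sphere Q n :=
  exist _ (f n.+1 (sval x)) (rel_sphere_map (svalP x)).

Lemma pi_rel_map_wd n (x y : rel_sphere P n) :
  rel_sph_homotopic x y ->
  pi_rel_cls (rel_sph_map x) = pi_rel_cls (rel_sph_map y).
Proof.
case=> xy Lx Ly [h Lh fill]; apply/pi_rel_clsP; split.
- by move=> i im; rewrite /= -!sfun_d xy.
- by rewrite /= -sfun_d; exact: pm_sub.
- by rewrite /= -sfun_d; exact: pm_sub.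
exists (f _ h); first exact: pm_sub.
apply: (proj1 (filled_ext _) (filled_map f fill)) => i _ /=.
case: ifP => // _; case: ifP => [_|_]; last by case: ifP.
by rewrite sfun_s sfun_d.
Qed.

Definition pi_rel_map n : pi_rel P n -> pi_rel Q n := qlift (@pi_rel_map_wd n).

Lemma pi_rel_mapE n (x : rel_sphere P n) :
  pi_rel_map (pi_rel_cls x) = pi_rel_cls (rel_sph_map x).
Proof. exact: qliftE. Qed.

Lemma pi_rel_mapM n : {morph @pi_rel_map n.+1 : a b / (a * b)%g}.
Proof.
elim/pi_rel_ind=> x; elim/pi_rel_ind=> y.
have [z h] := mr_mul (rel_sph_mulrel P n) x y.
have fh : rel_sph_mul (rel_sph_map x) (rel_sph_map y) (rel_sph_map z).
  case: h => h Lh fill; exists (f _ h); first exact: pm_sub.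
  apply: (proj1 (filled_ext _) (filled_map f fill)) => i _ /=.
  case: ifP => // _; case: ifP => _; first exact: (pkm_star (pmK f) n.+2).
  by case: ifP => // _; case: ifP.
by rewrite (pi_rel_mulE h) !pi_rel_mapE (pi_rel_mulE fh).
Qed.
End PairMap.

(** * The maps of the sequence *)

Section Sequence.
Variable P : kanpair.
Local Notation K := (pairK P).
Local Notation L := (pairL P).

Definition i_star n : pi L n -> pi K n := pi_map (pair_incl P) (n := n).

Lemma i_starE n (x : sphere L n) :
  i_star (pi_cls x) = pi_cls (sph_map (pair_incl P) x).
Proof. exact: pi_mapE. Qed.

Lemma sphere_rel n (x : K n.+1) : is_sphere x -> is_rel_sphere x.
Proof.
move=> hx; split; first by rewrite hx //; exact: subL_star.
by move=> i /andP[_ im]; rewrite hx.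
Qed.

Definition sph_to_rel n (x : sphere K n.+1) : rel_sphere P n :=
  exist _ (sval x) (sphere_rel (svalP x)).

Lemma p_star_wd n (x y : sphere K n.+1) :
  sph_homotopic x y -> pi_rel_cls (sph_to_rel x) = pi_rel_cls (sph_to_rel y).
Proof.
case=> xy fill; apply/pi_rel_clsP; have [hx hy] := (svalP x, svalP y).
split=> [i /andP[_ im]|||].
- exact: xy.
- by rewrite hx //; exact: subL_star.
- by rewrite hy //; exact: subL_star.
exists (star n.+1); first exact: subL_star.
apply: (proj1 (filled_ext _) fill) => -[|i] im //=.
by rewrite hx // (@s_star K).
Qed.

Definition p_star n : pi K n.+1 -> pi_rel P n := qlift (@p_star_wd n).

Lemma p_starE n (x : sphere K n.+1) :
  p_star (pi_cls x) = pi_rel_cls (sph_to_rel x).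
Proof. exact: qliftE. Qed.

Lemma sval_starL n : sval (star n : L n) = @star K n.
Proof. exact: (pkm_star (pair_incl P)). Qed.

Definition d0L n (x : rel_sphere P n) : L n :=
  exist _ (d 0 (sval x)) (proj1 (svalP x)).

Lemma d0L_sphere n (x : rel_sphere P n) : is_sphere (d0L x).
Proof.
case: n x => // n x i im; apply: sval_inj; rewrite sval_starL /=.
rewrite -/(d i (d 0 (sval x))) -[i in LHS]/(i.+1.-1) -(@dd _ _ 0); last lia.
by case: (svalP x) => _ ->; rewrite ?d_star.
Qed.

Definition bdry_sph n (x : rel_sphere P n) : sphere L n :=
  exist _ (d0L x) (d0L_sphere x).

Lemma bdry_star_wd n (x y : rel_sphere P n) :
  rel_sph_homotopic x y -> pi_cls (bdry_sph x) = pi_cls (bdry_sph y).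
Proof.
case=> xy Lx Ly [h Lh [w hw]]; apply/pi_clsP; split.
  have [sx sy] := (d0L_sphere x, d0L_sphere y).
  by case: n x y sx sy {xy Lx Ly h Lh w hw} => //= n x y sx sy i im;
    rewrite sx // sy.
exists (exist _ h Lh) => i im; apply: sval_inj => /=.
have h0 : d 0 w = h := hw 0 isT.
rewrite -/(d i h) -h0 -[i in LHS]/(i.+1.-1) -(@dd _ _ 0); last lia.
rewrite hw //= ltnS eqSS; case: ltnP => [lt_in|_]; last by case: ifP.
case: n x y {xy Lx Ly h Lh w hw h0} i im lt_in => //= n x y i im lt_in.
have e : d 0 (d i.+1 (sval x)) = d i (d 0 (sval x)).
  by apply: (@dd K n 0 i.+1); lia.
by rewrite ds_lt ?leqnn //; exact: (congr1 (@s K n n) e).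
Qed.

Definition bdry_star n : pi_rel P n -> pi L n := qlift (@bdry_star_wd n).

Lemma bdry_starE n (x : rel_sphere P n) :
  bdry_star (pi_rel_cls x) = pi_cls (bdry_sph x).
Proof. exact: qliftE. Qed.

Lemma i_star_base n : i_star (pi_base L n) = pi_base K n.
Proof.
by rewrite i_starE; congr pi_cls; apply: sval_inj; exact: sval_starL.
Qed.

Lemma p_star_base n : p_star (pi_base K n.+1) = pi_rel_base P n.
Proof. by rewrite p_starE; congr pi_rel_cls; apply: sval_inj. Qed.

Lemma bdry_star_base n : bdry_star (pi_rel_base P n) = pi_base L n.
Proof.
rewrite bdry_starE; congr pi_cls; do 2!apply: sval_inj.
by rewrite sval_starL; exact: (@d_star K n 0).
Qed.

(* The equivalence relation identifying all the points of the image of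
   [i_star] and nothing else. *)
Definition collapse (a b : pi K 0) : Prop :=
  a = b \/ range (@i_star 0) a /\ range (@i_star 0) b.

Lemma collapse_equiv : Equivalence collapse.
Proof.
split; first by left.
  by move=> a b [->|[? ?]]; [left|right].
by move=> a b c [->//|[? ?]] [<-|[? ?]]; right.
Qed.

Definition pi0_quot := quot collapse_equiv.
Definition pi0_proj : pi K 0 -> pi0_quot := cls collapse_equiv.
Definition pi0_base : pi0_quot := pi0_proj (pi_base K 0).
End Sequence.
Arguments i_star : clear implicits.
Arguments p_star : clear implicits.
Arguments bdry_star : clear implicits.
Arguments pi0_proj : clear implicits.
Arguments pi0_base : clear implicits.
Arguments pi_base : clear implicits.
Arguments pi_rel_base : clear implicits.

Lemma pmK_incl (P Q : kanpair) (f : pairmap P Q) n (a : pi (pairL P) n) :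
  pi_map (pmK f) (i_star P n a) = i_star Q n (pi_map (pmL f) a).
Proof.
move: a; elim/pi_ind => x; rewrite i_starE 2!pi_mapE i_starE.
by congr pi_cls; apply: sval_inj.
Qed.

Lemma pi0_map_wd (P Q : kanpair) (f : pairmap P Q) (a b : pi (pairK P) 0) :
  collapse a b ->
  pi0_proj Q (pi_map (pmK f) a) = pi0_proj Q (pi_map (pmK f) b).
Proof.
case=> [->//|[[a' _ <-] [b' _ <-]]]; apply/clsP; right.
by rewrite !pmK_incl; split; eexists.
Qed.

Definition pi0_map (P Q : kanpair) (f : pairmap P Q) :
  pi0_quot P -> pi0_quot Q := qlift (@pi0_map_wd P Q f).

(** * Exactness and naturality *)

Definition exact_at (A B C : Type) (f : A -> B) (g : B -> C) (c0 : C) : Prop :=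
  range f = g @^-1` [set c0].

Definition square_commutes (A B A' B' : Type) (top : A -> B)
  (bot : A' -> B') (left : A -> A') (right : B -> B') : Prop :=
  forall a, right (top a) = bot (left a).

Arguments pi_map {K K'} f n.
Arguments pi_rel_map {P Q} f n.
Arguments pi0_map {P Q} f.

(* Main.v *)
From mathcomp Require Import zify.
Require Import Defs.

(** Everything reduces to horn filling in [K] and in [L].

    A simplex of [K] whose 0-th face lies in [L] and whose other faces are trivial
    is a relative sphere, and it exhibits its 0-th face as null-homotopic in [K],
    except that a homotopy to the base point must carry the sphere in its last
    but one face instead. [filled_single] moves the only nontrivial face of a simplex to
    any other position, and this is exactness at [pi_n(L)].

    At [pi_n(K)], a sphere [l] of [L] becomes trivial relative to [L] by filling
    in [L] the horn [(-, pt, ..., pt, l, pt)]. Conversely, from a filled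
    [(h, pt, ..., pt, x, pt)] with [h] in [L], the horn
    [(h, pt, ..., pt, -, pt)] is filled in [L] with missing face [l], and two
    simplices that agree off their last but one faces have homotopic last but
    one faces ([homotopic_missing_face]); hence [x] is homotopic to [l].

    At [pi_n(K, L)], a homotopy [h] in [L] from [d_0 x] to the base point is
    just the 0-th face needed in the horn [(h, pt, ..., pt, x, -)]; the missing
    face of a filling is a sphere of [K] homotopic to [x] relative to [L].

    The boundary map is multiplicative because the 0-th face [h] of a simplex
    that witnesses a relative product [(h, pt, ..., pt, y, z, x)] lies in [L]
    and has the faces [(pt, ..., pt, d_0 y, d_0 z, d_0 x)]. *)

Set Implicit Arguments.
Unset Strict Implicit.
Unset Printing Implicit Defensive.

Local Open Scope classical_set_scope.

(** * Homotopies in Kan complexes *)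

Section Kan.
Variable K : pkan.

Let single n (k : nat) (x : K n) (i : nat) : K n :=
  if i == k then x else star n.

(** In an (n+2)-simplex whose faces other than the k-th and the (k+2)-nd are
    trivial, these two meet in [x], the former in its (k+1)-st face and the
    latter in its k-th; each is obtained from the other by filling a horn. *)
Lemma filled_single_shift n k (x : K n) : k <= n ->
  filled (single k x) <-> filled (single k.+1 x).
Proof.
move=> kn; split=> -[w hw].
  pose t i : K n.+1 := if i == k.+2 then w else star n.+1.
  have [||W hW] := @pk_kan K n.+1 k t; first lia.
    move=> i j /andP[ij jn] ik jk; rewrite /t.
    have [i2|i2] := eqVneq i k.+2; have [j2|j2] := eqVneq j k.+2; first lia.
    - by rewrite hw ?d_star /single ?ifF //; lia.
    - by rewrite hw ?d_star /single ?ifF //; lia.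
    - by rewrite !d_star //; lia.
  exists (d k W) => i im; case: (ltnP i k) => ik.
    rewrite dd ?hW /t /single; try lia.
    by rewrite !ifF ?d_star //; lia.
  rewrite -[i in LHS]/(i.+1.-1) -dd; last lia.
  rewrite hW /t /single; try lia.
  rewrite eqSS; case: ifP => _; last by rewrite d_star //; lia.
  by rewrite hw /single ?eqxx //; lia.
pose t i : K n.+1 := if i == k then w else star n.+1.
have [||W hW] := @pk_kan K n.+1 k.+2 t; first lia.
  move=> i j /andP[ij jn] ik jk; rewrite /t.
  have [i2|i2] := eqVneq i k; have [j2|j2] := eqVneq j k; first lia.
  - by rewrite hw ?d_star /single ?ifF //; lia.
  - by rewrite hw ?d_star /single ?ifF //; lia.
  - by rewrite !d_star //; lia.
exists (d k.+2 W) => i im; case: (ltnP i k.+2) => ik.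
  rewrite dd ?hW /t /single; try lia.
  case: ifP => ik'; last by rewrite d_star //; lia.
  by rewrite hw /single ?eqxx //; lia.
rewrite -[i in LHS]/(i.+1.-1) -dd; last lia.
rewrite hW /t /single; try lia.
by rewrite !ifF ?d_star //; lia.
Qed.

Lemma filled_single n k (x : K n) : k <= n.+1 ->
  filled (fun i => if i == 0 then x else star n) <->
  filled (fun i => if i == k then x else star n).
Proof.
elim: k => [//|k IH] kn; rewrite IH; last lia.
exact: filled_single_shift.
Qed.

(** By definition a homotopy to the base point carries the sphere in its n-th
    face; the 0-th face is the one that the boundary map reads. *)
Lemma sph_null n (x : sphere K n) : sph_homotopic x (star_sph K n) <->
  filled (fun i => if i == 0 then sval x else star n).
Proof.
have hx := svalP x.
rewrite (@filled_single n n); last lia.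
transitivity (filled (fun i => if i < n then sd i (sval x)
    else if i == n then sval x else star n)).
  split=> [[]//|fill]; split=> //=.
  case: n x hx {fill} => //= n x hx i im.
  by rewrite hx // (@d_star K n i).
apply: filled_ext => i im; case: ltnP => // lt_in.
rewrite ifF; last lia.
case: n x hx {im} lt_in => //= n x hx lt_in.
by rewrite hx ?s_star //; lia.
Qed.

(** The homotopy is the n-th face of an (n+2)-simplex whose last two faces are
    [w] and [w'] and whose faces below the n-th are degenerate on the common
    faces of [w] and [w']. *)
Lemma homotopic_missing_face n (w w' : K n.+1) :
  (forall i, i <= n.+1 -> i != n -> d i w = d i w') ->
  homotopic (d n w) (d n w').
Proof.
move=> ww'; pose t i : K n.+1 :=
  if i < n then s n (d i w) else if i == n.+1 then w else w'.
have [||W hW] := @pk_kan K n.+1 n t; first lia.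
  move=> i j /andP[ij jn] i_n j_n; rewrite /t.
  case: (ltnP i n) => im; last first.
    rewrite ifF; last lia.
    rewrite ifF; last lia.
    rewrite ifT; last lia.
    have [-> ->] : i = n.+1 /\ j = n.+2 by lia.
    by rewrite ww' //; lia.
  case: (ltnP j n) => jm.
    case: n w w' ww' {t} ij jn i_n j_n im jm => [//|n] w w' ww'.
    move=> ij jn i_n j_n im jm.
    by rewrite ds_lt ?[RHS]ds_lt ?(@dd _ _ i j) //; lia.
  case: eqP => [->|?]; first by rewrite /= ds_eq.
  have -> : j = n.+2 by lia.
  by rewrite /= ds_eqS // ww' //; lia.
split.
  case: n w w' ww' {t W hW} => //= n w w' ww' i im.
  case: (ltnP i n.+1) => i_n; first by rewrite !(@dd K n i n.+1) ?ww' //; lia.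
  have -> : i = n.+2.-1 by lia.
  by rewrite -!(@dd K n n.+1 n.+2) ?ww' //; lia.
have eqnS k : (k.+1 == k) = false by lia.
exists (d n W) => i im; case: (ltnP i n) => i_n.
  rewrite dd ?hW /t ?i_n; try lia.
  case: n w w' ww' {t W hW im} i_n => //= n w w' ww' i_n.
  by rewrite ds_lt ?leqnn //= (@dd K n i n.+1) //; lia.
rewrite -[i in LHS]/(i.+1.-1) -dd; last lia.
rewrite hW /t ?eqSS; try lia.
by rewrite ifF; [case: ifP|lia].
Qed.
End Kan.

(** * Exactness *)

Section Exactness.
Variable P : kanpair.
Local Notation K := (pairK P).
Local Notation L := (pairL P).

Lemma exact_at_piL n : exact_at (bdry_star P n) (i_star P n) (pi_base K n).
Proof.
apply/seteqP; split=> [_ [a _ <-]|b] /=.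
  move: a; elim/pi_rel_ind=> x; rewrite bdry_starE i_starE.
  apply/pi_clsP/sph_null; exists (sval x) => -[|i] im //=.
  by have [_ ->] := svalP x.
move: b; elim/pi_ind=> l; rewrite i_starE => /pi_clsP/sph_null[w hw].
have rw : is_rel_sphere w.
  split; first by rewrite (hw 0) //=; exact: (svalP (sval l)).
  by case=> // i im; rewrite hw.
exists (pi_rel_cls (exist _ w rw)) => //; rewrite bdry_starE.
by congr pi_cls; do 2!apply: sval_inj; rewrite /= hw.
Qed.

Lemma exact_at_piK n :
  exact_at (i_star P n.+1) (p_star P n) (pi_rel_base P n).
Proof.
apply/seteqP; split=> [_ [a _ <-]|b] /=.
  move: a; elim/pi_ind=> l; rewrite i_starE p_starE; apply/pi_rel_clsP.
  (* The 0-th face of a filling in [L] is the [h] of a relative homotopy from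
     [l] to the base point. *)
  pose t i : L n.+1 := if i == n.+1 then sval l else star n.+1.
  have ht i : i <= n.+2 -> i != 0 -> is_sphere (t i).
    by move=> _ _; rewrite /t; case: ifP => _;
      [exact: (svalP l)|exact: (@star_sphere L n.+1)].
  have [w hw _] := @sphere_horn L n t 0 isT ht.
  have [Lx hx] := svalP (sph_to_rel (sph_map (pair_incl P) l)).
  have [Ly hy] := svalP (rel_star_sph P n).
  split=> // [i im|]; first by rewrite hx // hy.
  exists (sval (d 0 w)); first exact: (svalP (d 0 w)).
  exists (sval w) => -[//|i] im.
  have {hw} := hw i.+1 im isT; rewrite /t /= => /(congr1 sval) /= e.
  rewrite [LHS]e eqSS; case: eqP => [->|?]; first by rewrite ltnn.
  case: ltnP => i_n; last exact: sval_starL.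
  rewrite [LHS]sval_starL; have := hx i.+1; rewrite /= => ->; last lia.
  by rewrite !(@s_star K).
move: b; elim/pi_ind=> x; rewrite p_starE => /pi_rel_clsP[_ _ _ [h Lh [w hw]]].
have dw0 : d 0 w = h := hw 0 isT.
have {}hw i : i <= n.+2 -> i != 0 ->
    d i w = if i == n.+1 then sval x else star n.+1.
  move=> im i0; rewrite hw // (negbTE i0); case: ltnP => // i_n.
  rewrite ifF; last lia.
  have -> : d i (sval (sph_to_rel x)) = star n by apply: (svalP x); lia.
  by rewrite (@s_star K).
have h0 i : i <= n.+1 -> d i (d 0 w) = star n.
  move=> im; rewrite -[i in LHS]/(i.+1.-1) -dd; last lia.
  by rewrite hw //; case: ifP => _; [apply: (svalP x)|rewrite d_star].
(* The same horn as that of [w], but filled in [L]: its missing face is the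
   required preimage. *)
pose hL : L n.+1 := exist _ h Lh.
have sh : is_sphere hL.
  by move=> i im; apply: sval_inj; rewrite sval_starL -(h0 i im) dw0.
pose t i : L n.+1 := if i == 0 then hL else star n.+1.
have [||u hu su] := @sphere_horn L n t n.+1; first lia.
  by move=> i _ _; rewrite /t; case: ifP => _ //; exact: (@star_sphere L n.+1).
exists (pi_cls (exist _ _ su)) => //; rewrite i_starE.
apply/esym/pi_clsP; have := @homotopic_missing_face K n.+1 w (sval u).
rewrite (hw n.+1) ?eqxx //; apply=> i im i_n.
rewrite -[RHS]/(sval (d i u)) hu // /t.
by case: eqP => [->//|/eqP i0]; rewrite hw // (negbTE i_n) sval_starL.
Qed.

Lemma exact_at_pi_rel n :
  exact_at (p_star P n) (bdry_star P n) (pi_base L n).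
Proof.
apply/seteqP; split=> [_ [a _ <-]|b] /=.
  move: a; elim/pi_ind=> x; rewrite p_starE bdry_starE.
  congr pi_cls; do 2!apply: sval_inj; rewrite sval_starL.
  exact: (svalP x).
move: b; elim/pi_rel_ind=> x; rewrite bdry_starE => /pi_clsP[_ [h hh]].
have [Lx hx] := svalP x.
have {}hh i : i <= n.+1 ->
    d i (sval h) = if i == n then d 0 (sval x) else star n.
  move=> im; rewrite -[LHS]/(sval (d i h)) hh //.
  case: ltnP => i_n; last by case: ifP => // _; exact: sval_starL.
  rewrite ifF; last lia.
  case: n x i i_n {h hh Lx hx im} => // n x i i_n.
  rewrite /sd (@d0L_sphere P n.+1 x); last lia.
  by rewrite s_star // sval_starL.
(* The null homotopy [h] of [d_0 x] extends [x] to a horn whose missing face is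
   a sphere. *)
pose t i : K n.+1 :=
  if i == 0 then sval h else if i == n.+1 then sval x else star n.+1.
have [||w hw] := @pk_kan K n.+1 n.+2 t; first lia.
  move=> i j /andP[ij jn] i2 j2; rewrite /t.
  have [j0 i1] : (j == 0) = false /\ (i == n.+1) = false by lia.
  rewrite j0 i1.
  case: (eqVneq i 0) => [->|i0]; case: (eqVneq j n.+1) => [->|j1].
  - by rewrite hh // eqxx.
  - by rewrite d_star // hh ?ifF //; lia.
  - by rewrite hx ?d_star //; lia.
  - by rewrite !d_star //; lia.
have sy : is_sphere (d n.+2 w : K n.+1).
  move=> i im; rewrite dd; last lia.
  rewrite hw /t; try lia.
  case: eqP => [_|i0]; first by rewrite hh // ifF //; lia.
  by case: eqP => _; [rewrite hx|rewrite d_star] => //; lia.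
exists (pi_cls (exist _ _ sy)) => //; rewrite p_starE.
apply/esym/pi_rel_clsP; have [Ly hy] := sphere_rel sy.
split=> // [i im|]; first by rewrite hx // hy.
exists (sval h); first exact: (svalP h).
exists w => i im; have [->|i2] := eqVneq i n.+2.
  by rewrite !ifF //; lia.
rewrite hw // /t; case: eqP => // i0; case: ltnP => i_n; last first.
  have -> : i = n.+1 by lia.
  by rewrite eqxx.
have -> : (i == n.+1) = false by lia.
by rewrite hx ?(@s_star K) //; lia.
Qed.

Lemma exact_at_pi0 : exact_at (i_star P 0) (pi0_proj P) (pi0_base P).
Proof.
apply/seteqP; split=> [a ra|a /clsP[->|[]//]].
  by apply/clsP; right; split=> //; exists (pi_base L 0) => //;
    exact: i_star_base.
by exists (pi_base L 0) => //; exact: i_star_base.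
Qed.
End Exactness.

(** * Multiplicativity *)

Lemma p_starM (P : kanpair) n : {morph p_star P n.+1 : a b / (a * b)%g}.
Proof.
elim/pi_ind=> x; elim/pi_ind=> y.
have [z xyz] := mr_mul (sph_mulrel (pairK P) n.+1) x y.
rewrite (pi_mulE xyz) !p_starE; apply/esym/pi_rel_mulE.
exists (star n.+2); first exact: subL_star.
by apply: (proj1 (filled_ext _) xyz) => -[|i] im.
Qed.

Lemma bdry_starM (P : kanpair) n : {morph bdry_star P n.+1 : a b / (a * b)%g}.
Proof.
elim/pi_rel_ind=> x; elim/pi_rel_ind=> y.
have [z xyz] := mr_mul (rel_sph_mulrel P n) x y.
rewrite (pi_rel_mulE xyz) !bdry_starE; apply/esym/pi_mulE.
have [h Lh [w hw]] := xyz.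
have h0 : d 0 w = h := hw 0 isT.
exists (exist _ h Lh) => i im; apply: sval_inj.
rewrite -[LHS]/(d i h) -h0 -[i in LHS]/(i.+1.-1) -(@dd _ _ 0); last lia.
rewrite hw //= ltnS !eqSS; case: ifP => _; last by case: ifP => // _; case: ifP.
by rewrite [RHS]sval_starL; exact: (@d_star (pairK P) n.+1 0).
Qed.

(** * The exact sequence *)

Theorem mainTheorem3 (P : kanpair) :
  [/\ forall n, exact_at (bdry_star P n) (i_star P n) (pi_base (pairK P) n),
      forall n, exact_at (i_star P n.+1) (p_star P n) (pi_rel_base P n),
      forall n, exact_at (p_star P n) (bdry_star P n) (pi_base (pairL P) n) &
      exact_at (i_star P 0) (pi0_proj P) (pi0_base P)] /\
  [/\ forall n, {morph i_star P n.+1 : a b / (a * b)%g},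
      forall n, {morph p_star P n.+1 : a b / (a * b)%g} &
      forall n, {morph bdry_star P n.+1 : a b / (a * b)%g}] /\
  forall (Q : kanpair) (f : pairmap P Q),
  [/\ forall n, square_commutes (i_star P n) (i_star Q n)
                  (pi_map (pmL f) n) (pi_map (pmK f) n),
      forall n, square_commutes (p_star P n) (p_star Q n)
                  (pi_map (pmK f) n.+1) (pi_rel_map f n),
      forall n, square_commutes (bdry_star P n) (bdry_star Q n)
                  (pi_rel_map f n) (pi_map (pmL f) n) &
      square_commutes (pi0_proj P) (pi0_proj Q)
                  (pi_map (pmK f) 0) (pi0_map f)].
Proof.
split; first by split; [exact: exact_at_piL|exact: exact_at_piK
  |exact: exact_at_pi_rel|exact: exact_at_pi0].
split; first by split=> n; [exact: pi_mapM|exact: p_starM|exact: bdry_starM].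
move=> Q f; split=> [n a|n||a].
- exact: pmK_incl.
- elim/pi_ind=> x; rewrite p_starE pi_rel_mapE pi_mapE p_starE.
  by congr pi_rel_cls; apply: sval_inj.
- move=> n; elim/pi_rel_ind=> x.
  rewrite bdry_starE pi_mapE pi_rel_mapE bdry_starE.
  by congr pi_cls; do 2!apply: sval_inj => /=; rewrite sfun_d.
- exact: qliftE.
Qed.
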